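(* Fix a positive integer $k$ and real numbers $\alpha,\beta\in(0,1)$ with $\alpha+\beta\geq1$. Let $\ell=\ell(n)\geq 2$ be an integer-valued function with $\ell=o(\sqrt{n})$. Then for all sufficiently large $n$ there is a cyclic ordering $S_0,S_1,\dots,S_{m-1}$ (indices mod $m$, $m=\binom nk$) of all $k$-element subsets of $[n]$ such that: (1) for every $i$, the $\ell$ consecutive sets $S_i,S_{i+1},\dots,S_{i+\ell-1}$ are pairwise disjoint, hence form a $(k,\ell)$-parpartition of $[n]$ (a consecutive-$(k,\ell)$-parpartition); and (2) any two consecutive-$(k,\ell)$-parpartitions $P_1=\{S_i,\dots,S_{i+\ell-1}\}$ and $P_2=\{S_j,\dots,S_{j+\ell-1}\}$ that share no set (i.e. the index windows are disjoint) are not $(\alpha,\beta)$-close.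
   Context: A $(k,\ell)$-parpartition of $[n]$ is a family of $\ell$ pairwise disjoint $k$-element subsets of $[n]$. Two parpartitions $P_1,P_2$ are $(\alpha,\beta)$-close if there exist sets $A_1\neq B_1$ in $P_1$ and $A_2\neq B_2$ in $P_2$ with $|A_1\cap A_2|>\alpha k$ and $|B_1\cap B_2|>\beta k$. *)

(* Defs.v *)
From HB Require Import structures.
From mathcomp Require Import all_boot all_order all_algebra.
From mathcomp Require Import reals.
Set Implicit Arguments. Unset Strict Implicit. Unset Printing Implicit Defensive.
Import Order.TTheory GRing.Theory Num.Theory.
Local Open Scope ring_scope.

Definition close (R : realType) (n k : nat) (alpha beta : R)
    (P1 P2 : {set {set 'I_n}}) : Prop :=
  exists A1 B1 A2 B2,
    [/\ A1 \in P1, B1 \in P1 & A1 != B1] /\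
    [/\ A2 \in P2, B2 \in P2 & A2 != B2] /\
    alpha * k%:R < #|A1 :&: A2|%:R /\ beta * k%:R < #|B1 :&: B2|%:R.

Definition cyc (n : nat) (s : seq {set 'I_n}) (i : nat) : {set 'I_n} :=
  nth set0 s (i %% size s)%N.

Definition window (n : nat) (s : seq {set 'I_n}) (l i : nat) : {set {set 'I_n}} :=
  [set cyc s (i + val a)%N | a : 'I_l].

Definition little_o_sqrt (R : realType) (l : nat -> nat) : Prop :=
  forall eps : R, 0 < eps -> exists N : nat, forall n : nat, (N <= n)%N ->
    (l n)%:R <= eps * Num.sqrt (n%:R : R).

(* Main.v *)
Require Import Defs.
From HB Require Import structures.
From mathcomp Require Import all_boot all_order all_algebra.
From mathcomp Require Import reals.
From mathcomp Require Import zify.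
Set Implicit Arguments. Unset Strict Implicit. Unset Printing Implicit Defensive.
Import Order.TTheory GRing.Theory Num.Theory.
Local Open Scope ring_scope.

(** The ordering is built by inserting one [k]-set at a time into a cyclic
    sequence without violations.  Insertion never brings two old sets closer,
    so every new violation involves the inserted set.  Since [a + b > k]
    whenever [a > alpha k] and [b > beta k], only [O(l^2 n^(k-1)) = o('C(n, k))]
    positions are forbidden for a given set, and as few sets are forbidden at a
    given position.  Hence one can always insert: while less than half of the
    sets are placed, fix the position and choose the set; afterwards, fix the
    set and choose the position. *)

(** * Cyclic sequences *)

Section CyclicSeq.

Local Open Scope nat_scope.

Variable T : eqType.
Implicit Types (s u v : seq T) (x A B : T) (l i j q : nat).

Lemma nth_rot x0 s q j : q <= size s -> j < size s ->
  nth x0 (rot q s) j = nth x0 s ((q + j) %% size s).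
Proof.
move=> le_q lt_j; rewrite /rot nth_cat size_drop nth_drop.
case: ltnP => h; first by rewrite modn_small //; lia.
rewrite nth_take; last by lia.
have -> : q + j = (j - (size s - q)) + size s by lia.
by rewrite modnDr modn_small //; lia.
Qed.

(** Windows are prefixes of rotations, which handles wrap-around without modular indices; an [i]
    beyond [size s] just gives the prefix of [s] itself. *)
Definition near l s A B :=
  exists i, (A \in take l (rot i s)) && (B \in take l (rot i s)).

(* The elements at distance less than [l] from an element inserted at the head. *)
Definition ends l s := take l s ++ drop (size s - l) s.

Lemma near_sym l s A B : near l s A B -> near l s B A.
Proof. by case=> i; rewrite andbC; exists i. Qed.

Lemma near_mem l s A B : near l s A B -> (A \in s) && (B \in s).
Proof.
by case=> i /andP[/mem_take + /mem_take]; rewrite !mem_rot => -> ->.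
Qed.

Lemma near_rotW l s q A B : near l (rot q s) A B -> near l s A B.
Proof.
case=> i; case: (leqP (size s) q) => hq.
  by rewrite (rot_oversize hq); exists i.
case: (leqP (size s) i) => hi.
  by rewrite rot_oversize ?size_rot //; exists q.
by rewrite rot_add_mod ?(ltnW hq) ?(ltnW hi) //; eexists; eassumption.
Qed.

Lemma near_rot l s q A B : near l s A B -> near l (rot q s) A B.
Proof. by rewrite -{1}[s](rotK q) /rotr; apply: near_rotW. Qed.

Lemma rot_cons_shape x s i : exists j, rot i (x :: s) = drop j s ++ x :: take j s.
Proof.
case: i => [|i]; last by exists i.
by exists (size s); rewrite rot0 drop_size take_size.
Qed.

(** Deleting [x] from a window of [x :: s] leaves a part of a window of [s], so inserting [x]
    creates no new near pair among the old entries. *)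
Lemma near_cons l x s A B : A != x -> B != x ->
  near l (x :: s) A B -> near l s A B.
Proof.
have sub C u v : C != x -> C \in take l (u ++ x :: v) -> C \in take l (u ++ v).
  move=> neCx; rewrite !take_cat; case: ltnP => // _.
  rewrite !mem_cat; case: (l - size u) => [|m]; first by rewrite !take0.
  rewrite /= in_cons (negPf neCx) /= => /orP[->//|h]; apply/orP; right.
  by move: h; rewrite -[in take m v](minn_idPl (leqnSn m)) take_min => /mem_take.
move=> neA neB [i]; have [j ->] := rot_cons_shape x s i.
by move=> /andP[/(sub _ _ _ neA) hA /(sub _ _ _ neB) hB]; exists j; apply/andP.
Qed.

Lemma near_head l x s B : x \notin s -> B != x ->
  near l (x :: s) x B -> B \in ends l s.
Proof.
move=> xs neBx [i]; have [j ->] := rot_cons_shape x s i.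
have xd : x \notin drop j s by apply: contra xs => /mem_drop.
rewrite take_cat; case: ltnP => h.
  by move=> /andP[/mem_take]; rewrite (negPf xd).
rewrite !mem_cat (negPf xd) /=; move: h; rewrite size_drop => h.
case e: (l - (size s - j)) => [|m] // /andP[_].
rewrite /= in_cons (negPf neBx) /= => /orP[hB|hB].
  apply/orP; right; move: hB.
  have -> : j = (j - (size s - l)) + (size s - l) by lia.
  by rewrite -drop_drop => /mem_drop.
apply/orP; left; move: hB.
have -> : take m (take j s) = take (minn m j) (take l s).
  by rewrite -!take_min; congr (take _ s); lia.
exact: mem_take.
Qed.

Lemma size_ends l s : size (ends l s) <= 2 * l.
Proof. by rewrite size_cat size_take size_drop; case: ltnP; lia. Qed.

Lemma mem_ends l s A : A \in ends l s -> A \in s.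
Proof. by rewrite mem_cat => /orP[/mem_take|/mem_drop]. Qed.

(** Bringing [B] to the front and removing it presents [s], up to rotation, as an insertion of [B],
    so [ends] applies. For [B] outside [s] the value is junk, but still has at most [2 * l]
    entries. *)
Definition nbrs l s B := ends l (behead (rot (index B s) s)).

Lemma near_nbrs l s A B : uniq s -> A != B -> near l s B A -> A \in nbrs l s B.
Proof.
move=> us neAB nBA; have /andP[Bs _] := near_mem nBA.
move: (us) (near_rot (index B s) nBA); rewrite -(rot_uniq (index B s)) /nbrs.
rewrite rot_index //= => /andP[Bn _].
exact: near_head.
Qed.

Lemma index_rot s B q : uniq s -> B \in s -> q < size s ->
  (q + index B (rot q s)) %% size s = index B s.
Proof.
move=> us Bs lq.
have lj : index B (rot q s) < size s by rewrite -(size_rot q) index_mem mem_rot.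
have e := nth_index B (s := rot q s) (etrans (mem_rot _ _ _) Bs).
rewrite nth_rot ?(ltnW lq) // in e.
rewrite -{2}e index_uniq // ltn_mod; lia.
Qed.

(** The map sending [q] to the index of [B] in [rot q s] is injective, and on the gaps counted here
    it takes values among the first [l] or last [l] positions. *)
Lemma card_gaps l s B : uniq s ->
  #|[set q : 'I_(size s) | B \in ends l (rot q s)]| <= 2 * l.
Proof.
move=> us; case: (boolP (B \in s)) => [Bs|Bs]; last first.
  rewrite eq_card0 // => q; rewrite !inE; apply/negP => /mem_ends.
  by rewrite mem_rot (negPf Bs).
set A := [set _ | _]; rewrite cardE -(size_map (fun q : 'I__ => index B (rot q s))).
have -> : 2 * l = size (iota 0 l ++ iota (size s - l) l).
  by rewrite size_cat !size_iota; lia.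
apply: uniq_leq_size.
  rewrite map_inj_in_uniq ?enum_uniq // => q q' _ _ e; apply/val_inj => /=.
  have := index_rot us Bs (ltn_ord q); rewrite e -(index_rot us Bs (ltn_ord q')).
  move/eqP; rewrite eqn_modDr !modn_small // => /eqP //.
move=> j /mapP[q]; rewrite mem_enum inE => hB ->.
have lj : index B (rot q s) < size s
  by rewrite -[X in _ < X](size_rot q) index_mem mem_rot.
move: hB; rewrite !mem_cat !mem_iota => /orP[/index_ltn ->//|].
rewrite size_rot => hB; apply/orP; right.
have : B \notin take (size s - l) (rot q s).
  apply/negP => hB'; move: us; rewrite -(rot_uniq q).
  rewrite -[rot q s](cat_take_drop (size s - l)) cat_uniq => /and3P[_ /hasPn h _].
  by have := h _ hB; rewrite /= hB'.
rewrite in_take_leq ?size_rot ?leq_subr //; lia.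
Qed.

End CyclicSeq.

Lemma card_nbrs (T : finType) l (s : seq T) B (P : pred T) :
  (#|[pred A in nbrs l s B | P A]| <= 2 * l)%N.
Proof.
apply: leq_trans (size_ends l (behead (rot (index B s) s))).
apply: leq_trans (card_size _).
by apply/subset_leq_card/subsetP => A /andP[].
Qed.

(** * Counting sets with large intersections *)

Section Counting.

Local Open Scope nat_scope.

Lemma leq_card_bigcup (I T : finType) (A : {pred I}) (F : I -> {set T}) a c :
  #|A| <= a -> (forall i, i \in A -> #|F i| <= c) ->
  #|\bigcup_(i in A) F i| <= a * c.
Proof.
move=> hA hF; apply: (@leq_trans (\sum_(i in A) #|F i|)).
  elim/big_ind2: _ => [|x X y Y hX hY|//]; first by rewrite cards0.
  apply: leq_trans (leq_add hX hY).
  by case: (leq_card_setU X Y).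
apply: leq_trans (leq_mul hA (leqnn c)).
by rewrite -sum_nat_const; apply: leq_sum.
Qed.

Lemma exists_notin (T : finType) (B A : {set T}) : #|B| < #|A| ->
  exists x, (x \in A) && (x \notin B).
Proof.
move=> lt; have /subsetPn[x xA xB] : ~~ (A \subset B).
  by apply: contraTN lt => /subset_leq_card; rewrite -leqNgt.
by exists x; rewrite xA.
Qed.

Lemma leq_bin_expn n j : 'C(n, j) <= n ^ j.
Proof.
apply: leq_trans (leq_pmulr _ (fact_gt0 j)) _; rewrite bin_ffact.
elim: j => // j IH; by rewrite ffactnSr expnSr leq_mul // leq_subr.
Qed.

(** Each factor [n - j] with [j < k] of the falling factorial is at least [n / 2]. *)
Lemma expn_leq_bin n k : 2 * k <= n -> n ^ k <= 2 ^ k * k`! * 'C(n, k).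
Proof.
move=> hk; rewrite -mulnA [k`! * _]mulnC bin_ffact.
suff H j : j <= k -> n ^ j <= 2 ^ j * n ^_ j by apply: H.
elim: j => // j IH hj; rewrite ffactnSr !expnSr.
rewrite mulnACA leq_mul ?IH //; lia.
Qed.

Definition meeting n k (A : {set 'I_n}) a : {set {set 'I_n}} :=
  [set X : {set 'I_n} | (#|X| == k) && (a <= #|X :&: A|)].

(** Such an [X] is the union of an [a]-element subset of [A] and a set of size [k - a]: at most
    [2 ^ k] choices for the former and [n ^ (k - a)] for the latter. *)
Lemma card_meeting n k (A : {set 'I_n}) a : #|A| = k -> a <= k ->
  #|meeting k A a| <= 2 ^ k * n ^ (k - a).
Proof.
move=> cA ak.
pose Y := [set Z : {set 'I_n} | #|Z| == k - a].
apply: (@leq_trans #|setX (powerset A) Y|); last first.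
  rewrite cardsX card_powerset cA leq_mul // card_draws card_ord.
  exact: leq_bin_expn.
apply: leq_trans (leq_imset_card (fun p => p.1 :|: p.2) _).
apply/subset_leq_card/subsetP => X; rewrite inE => /andP[/eqP cX].
move=> /card_geqP[t [ut st sub]].
have cT : #|[set x in t]| = a by rewrite cardsE; move/card_uniqP: ut => ->.
have sT : [set x in t] \subset X :&: A by apply/subsetP => x; rewrite inE => /sub.
apply/imsetP; exists ([set x in t], X :\: [set x in t]) => /=.
  rewrite !inE /= (subset_trans sT) ?subsetIr //= cardsD (setIidPr _) ?cT ?cX //.
  by rewrite (subset_trans sT) ?subsetIl.
rewrite -{1}(setID X [set x in t]) (setIidPr _) //.
by rewrite (subset_trans sT) ?subsetIl.
Qed.

End Counting.

(** * Insertion *)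

Section Insertion.

Local Open Scope nat_scope.

Variables n k l : nat.
Hypothesis k_gt0 : 0 < k.
Implicit Types (x A B : {set 'I_n}) (s : seq {set 'I_n}).

(** The last clause replaces closeness by an integer inequality free of [alpha] and [beta]. It asks
    only [A1 != A2] and [B1 != B2] instead of disjoint windows, so it is a stronger invariant. *)
Definition good s :=
  [/\ uniq s, (forall A, A \in s -> #|A| = k),
      (forall A B, A != B -> near l s A B -> #|A :&: B| = 0) &
      (forall A1 B1 A2 B2, A1 != B1 -> near l s A1 B1 ->
         A2 != B2 -> near l s A2 B2 -> A1 != A2 -> B1 != B2 ->
         #|A1 :&: A2| + #|B1 :&: B2| <= k)].

Definition admissible x s :=
  (forall B, B \in ends l s -> #|x :&: B| = 0) /\
  (forall B1 A2 B2, B1 \in ends l s -> A2 != B2 -> near l s A2 B2 ->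
     #|x :&: A2| + #|B1 :&: B2| <= k).

Lemma good_rot q s : good s -> good (rot q s).
Proof.
case=> us ks ds cs; split; first by rewrite rot_uniq.
- by move=> A; rewrite mem_rot; apply: ks.
- by move=> A B neAB /near_rotW; apply: ds.
by move=> A1 B1 A2 B2 ne1 /near_rotW n1 ne2 /near_rotW n2; apply: cs.
Qed.

Lemma good_cons x s : good s -> x \notin s -> #|x| = k -> admissible x s ->
  good (x :: s).
Proof.
case=> us ks ds cs xs kx [ad1 ad2].
have dis A B : A != B -> near l (x :: s) A B -> #|A :&: B| = 0.
  move=> neAB; have [eA|neA] := eqVneq A x.
    rewrite eA in neAB *; rewrite eq_sym in neAB.
    by move=> /(near_head xs neAB)/ad1.
  have [->|neB] := eqVneq B x; last by move=> /(near_cons neA neB)/ds; apply.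
  by rewrite setIC => /near_sym /(near_head xs neA)/ad1.
(* The case [A1 = x]. The other positions of [x] reduce to it by swapping the two members of each
   pair or by swapping the two pairs. *)
have new B1 A2 B2 : B1 != x -> near l (x :: s) x B1 ->
    A2 != B2 -> near l (x :: s) A2 B2 -> A2 != x ->
    #|x :&: A2| + #|B1 :&: B2| <= k.
  move=> neB1 n1 ne2 n2 neA2.
  (* If [x] occurs in both pairs, then [A2] is near [x], hence disjoint from it, and the other
     intersection lies inside [x]. *)
  have [e|neB2] := eqVneq B2 x.
    rewrite e in n2 *; rewrite [x :&: A2]setIC dis // add0n -kx.
    by rewrite subset_leq_card ?subsetIr.
  exact: ad2 (near_head xs neB1 n1) ne2 (near_cons neA2 neB2 n2).
split=> //=; first by rewrite xs.
  by move=> A; rewrite inE => /predU1P[->|/ks].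
move=> A1 B1 A2 B2 ne1 n1 ne2 n2 neA neB.
have [e|neA1] := eqVneq A1 x.
  by rewrite e in ne1 n1 neA *; apply: new; rewrite // eq_sym.
have [e|neB1] := eqVneq B1 x.
  rewrite e in ne1 n1 neB *; rewrite addnC.
  by apply: new; rewrite // 1?eq_sym //; apply: near_sym.
have [e|neA2] := eqVneq A2 x.
  rewrite e in ne2 n2 neA *; rewrite setIC [B1 :&: _]setIC.
  by apply: new; rewrite // eq_sym.
have [e|neB2] := eqVneq B2 x.
  rewrite e in ne2 n2 neB *; rewrite addnC setIC [A1 :&: _]setIC.
  by apply: new; rewrite // 1?eq_sym //; apply: near_sym.
by apply: cs => //; apply: near_cons; eassumption.
Qed.

(** One bound for two counts: bad gaps for a given set, and bad sets for a given gap. The first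
    summand covers failures of disjointness, the second the [k] possible thresholds [b] for a
    failure of the sum condition. *)
Definition forbidden :=
  2 * l * (2 ^ k * n ^ k.-1) + k * ((2 * l * 2 ^ k) ^ 2 * n ^ k.-1).

(** If the two intersections add up to more than [k], then [b = #|B1 :&: B2| - 1] satisfies [b < k]
    and [k - b <= #|x :&: A2|]. Thus [k] pairs of thresholds detect every violation. *)
Lemma admissibleP x s : good s -> #|x| = k ->
  (forall B, #|B| = k -> B \in ends l s -> B \notin meeting k x 1) ->
  (forall (b : 'I_k) B1 A2 B2, #|B1| = k -> B1 \in ends l s -> A2 != B2 ->
     near l s A2 B2 -> #|A2| = k -> #|B2| = k ->
     A2 \in meeting k x (k - b) -> B1 \notin meeting k B2 b.+1) ->
  admissible x s.
Proof.
case=> us ks ds cs kx h1 h2; split=> [B hB|B1 A2 B2 hB1 neAB nAB].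
  have kB := ks _ (mem_ends hB).
  by have := h1 B kB hB; rewrite inE kB eqxx /= -ltnNge setIC; lia.
have /andP[/ks kA2 /ks kB2] := near_mem nAB.
have kB1 := ks _ (mem_ends hB1).
have lB : #|B1 :&: B2| <= k by rewrite -kB1 subset_leq_card ?subsetIl.
have lA : #|x :&: A2| <= k by rewrite -kx subset_leq_card ?subsetIl.
rewrite leqNgt; apply/negP => lt.
have ltb : #|B1 :&: B2|.-1 < k by lia.
have := h2 (Ordinal ltb) B1 A2 B2 kB1 hB1 neAB nAB kA2 kB2.
have h0 : 0 < #|B1 :&: B2| by lia.
have hA : k - #|B1 :&: B2|.-1 <= #|x :&: A2| by lia.
by rewrite !inE kA2 kB1 eqxx [A2 :&: x]setIC /= hA => /(_ isT); rewrite ltn_predL h0.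
Qed.

(** The thresholds [b + 1] and [k - b] sum to [k + 1], so the two exponents of [n] sum to [k - 1]
    for every [b]: one factor [n] is saved against ['C(n, k)]. *)
Lemma forbidden_leq (T : finType) (F1 : {set T}) (F2 : 'I_k -> {set T}) :
  #|F1| <= 2 * l * (2 ^ k * n ^ k.-1) ->
  (forall b, #|F2 b| <= (2 * l * 2 ^ k) ^ 2 * (n ^ (k - b.+1) * n ^ (k - (k - b)))) ->
  #|F1 :|: \bigcup_b F2 b| <= forbidden.
Proof.
move=> h1 h2; case: (leq_card_setU F1 (\bigcup_b F2 b)) => /leq_trans + _.
apply; rewrite leq_add //; apply: leq_card_bigcup; first by rewrite card_ord.
move=> b _; have -> : k.-1 = (k - b.+1) + (k - (k - b)).
  by have := ltn_ord b; lia.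
by rewrite expnD.
Qed.

Lemma exists_gap x s : good s -> #|x| = k -> forbidden < size s ->
  exists q, admissible x (rot q s).
Proof.
move=> gs kx lt; have [us ks _ _] := gs.
pose G B := [set q : 'I_(size s) | B \in ends l (rot q s)].
pose kM A a := meeting k A a.
pose F1 := \bigcup_(B in kM x 1) G B.
(* A violation is a chain starting from the fixed [x]: a set [A2] meeting [x], its neighbour [B2], a
   set [B1] meeting [B2], and a gap having [B1] among its ends. *)
pose F2 (b : 'I_k) := \bigcup_(A2 in kM x (k - b))
  \bigcup_(B2 in [pred B2 in nbrs l s A2 | #|B2| == k])
  \bigcup_(B1 in kM B2 b.+1) G B1.
have hG B : #|G B| <= 2 * l by apply: card_gaps.
have le : #|F1 :|: \bigcup_b F2 b| <= forbidden.
  apply: forbidden_leq => [|b].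
    rewrite mulnC -subn1; apply: leq_card_bigcup => //.
    exact: card_meeting.
  rewrite (_ : _ * _ = 2 ^ k * n ^ (k - (k - b)) *
             (2 * l * (2 ^ k * n ^ (k - b.+1) * (2 * l)))); last by lia.
  apply: leq_card_bigcup => [|A2 _]; first by apply: card_meeting; rewrite ?leq_subr.
  apply: leq_card_bigcup => [|B2 /andP[_ /eqP kB2]]; first exact: card_nbrs.
  by apply: leq_card_bigcup => //; apply: card_meeting.
have [|q] := @exists_notin _ (F1 :|: \bigcup_b F2 b) setT.
  by rewrite cardsT card_ord (leq_ltn_trans le).
rewrite inE in_setU negb_or /= => /andP[/bigcupP n1 /bigcupP n2]; exists q.
apply: admissibleP => //; first exact: good_rot.
  move=> B kB hB; apply/negP => h; apply: n1; exists B => //; by rewrite inE.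
move=> b B1 A2 B2 kB1 hB1 neAB /near_rotW nAB kA2 kB2 hA2; apply/negP => h.
apply: n2; exists b => //; apply/bigcupP; exists A2 => //.
apply/bigcupP; exists B2; last by apply/bigcupP; exists B1 => //; rewrite inE.
by rewrite !inE kB2 eqxx andbT; apply: near_nbrs; rewrite // eq_sym.
Qed.

Lemma exists_new s : good s -> forbidden + size s < 'C(n, k) ->
  exists x, [/\ #|x| = k, x \notin s & admissible x s].
Proof.
move=> gs lt; have [us ks _ _] := gs.
pose kM A a := meeting k A a.
pose E := [pred B in ends l s | #|B| == k].
pose F1 := \bigcup_(B in E) kM B 1.
(* The same chain read backwards: the gap fixes the candidates for [B1], and [x] is the last
   choice. *)
pose F2 (b : 'I_k) := \bigcup_(B1 in E) \bigcup_(B2 in kM B1 b.+1)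
  \bigcup_(A2 in [pred A2 in nbrs l s B2 | #|A2| == k]) kM A2 (k - b).
have cE : #|E| <= 2 * l.
  apply: leq_trans (size_ends l s); apply: leq_trans (card_size _).
  by apply/subset_leq_card/subsetP => A /andP[].
have le : #|F1 :|: \bigcup_b F2 b| <= forbidden.
  apply: forbidden_leq => [|b].
    rewrite -subn1; apply: leq_card_bigcup => // B /andP[_ /eqP kB].
    exact: card_meeting.
  rewrite (_ : _ * _ = 2 * l * (2 ^ k * n ^ (k - b.+1) *
             (2 * l * (2 ^ k * n ^ (k - (k - b)))))); last by lia.
  apply: leq_card_bigcup => // B1 /andP[_ /eqP kB1].
  apply: leq_card_bigcup => [|B2 _]; first by apply: card_meeting.
  apply: leq_card_bigcup => [|A2 /andP[_ /eqP kA2]]; first exact: card_nbrs.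
  by apply: card_meeting; rewrite ?leq_subr.
have [|x] := @exists_notin _ ((F1 :|: \bigcup_b F2 b) :|: [set A in s])
               [set A : {set 'I_n} | #|A| == k].
  rewrite card_draws card_ord; apply: leq_ltn_trans lt.
  case: (leq_card_setU (F1 :|: \bigcup_b F2 b) [set A in s]) => /leq_trans + _.
  by apply; rewrite leq_add // cardsE card_size.
rewrite !in_setU in_set !negb_or inE => /andP[/eqP kx].
move=> /andP[/andP[/bigcupP n1 /bigcupP n2] xs]; exists x; split=> //.
apply: admissibleP => //.
  move=> B kB hB; apply/negP; rewrite inE setIC => /andP[_ h].
  by apply: n1; exists B; rewrite !inE ?kB ?kx ?eqxx ?hB.
move=> b B1 A2 B2 kB1 hB1 neAB nAB kA2 kB2.
rewrite inE setIC => /andP[_ hA2]; apply/negP; rewrite inE setIC => /andP[_ h].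
apply: n2; exists b => //; apply/bigcupP; exists B1; first by rewrite inE hB1 kB1 /=.
apply/bigcupP; exists B2; first by rewrite inE kB2 eqxx.
apply/bigcupP; exists A2; last by rewrite inE kx eqxx.
by rewrite !inE kA2 eqxx andbT; apply: near_nbrs => //; apply: near_sym.
Qed.

Lemma exists_good : 2 * forbidden < 'C(n, k) ->
  exists s, good s /\ size s = 'C(n, k).
Proof.
move=> lt; suff H t : t <= 'C(n, k) -> exists s, good s /\ size s = t by exact: H.
elim: t => [_|t IH ht].
  exists [::]; split=> //; split=> // [A B _ /near_mem //|].
  by move=> A1 B1 A2 B2 _ /near_mem.
have [s [gs st]] := IH (ltnW ht).
case: (leqP 'C(n, k) (forbidden + t)) => h; last first.
  have [|x [kx xs ax]] := exists_new gs; first by rewrite st.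
  by exists (x :: s); split; [exact: good_cons | rewrite /= st].
have [|x] := @exists_notin _ [set A in s] [set A : {set 'I_n} | #|A| == k].
  by rewrite card_draws card_ord cardsE (leq_ltn_trans (card_size s)) ?st.
rewrite !inE => /andP[/eqP kx xs].
have [|q aq] := exists_gap gs kx; first by rewrite st; lia.
exists (x :: rot q s); split; last by rewrite /= size_rot st.
by apply: good_cons => //; [exact: good_rot | rewrite mem_rot].
Qed.

End Insertion.

(** * Asymptotic estimate and the cyclic ordering *)

Lemma near_cyc n l (s : seq {set 'I_n}) i a b : (l <= size s)%N ->
  (a < l)%N -> (b < l)%N -> near l s (cyc s (i + a)) (cyc s (i + b)).
Proof.
move=> ls la lb; exists (i %% size s)%N.
suff H c : (c < l)%N -> cyc s (i + c) \in take l (rot (i %% size s) s).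
  by rewrite !H.
move=> lc; have lt : (0 < size s)%N by lia.
have -> : cyc s (i + c) = nth set0 (take l (rot (i %% size s) s)) c.
  by rewrite nth_take // nth_rot ?modnDml ?(leq_trans lc) // ltnW // ltn_mod.
by rewrite mem_nth // size_takel ?size_rot.
Qed.

(** Chosen so that [2 ^ k * k! * 2 * forbidden n k l] is at most [threshold k * l ^ 2 * n ^ k.-1],
    the linear term in [l] being absorbed into [l ^ 2]. *)
Definition threshold k := (2 ^ k * k`! * 2 * (2 * 2 ^ k + k * (2 * 2 ^ k) ^ 2))%N.

Lemma forbidden_small n k l : (0 < k)%N -> (2 * k <= n)%N ->
  (threshold k * l ^ 2 < n)%N -> (2 * forbidden n k l < 'C(n, k))%N.
Proof.
move=> k0 kn lt; have n0 : (0 < n)%N by lia.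
have c0 : (0 < 2 ^ k * k`!)%N by rewrite muln_gt0 expn_gt0 fact_gt0.
rewrite -(ltn_pmul2l c0); apply: leq_trans (expn_leq_bin kn).
have -> : (n ^ k = n * n ^ k.-1)%N by rewrite -expnS prednK.
apply: (@leq_ltn_trans (threshold k * l ^ 2 * n ^ k.-1)); last first.
  by rewrite ltn_pmul2r // expn_gt0 n0.
have l2 : (l <= l ^ 2)%N by rewrite -{1}[l]expn1; case: (l) => // m; rewrite leq_pexp2l.
rewrite /threshold -!mulnA !leq_mul2l; do !(apply/orP; right).
rewrite /forbidden mulnDl leq_add //.
  by rewrite mulnACA leq_mul // mulnA leq_mul.
by rewrite -!mulnn; lia.
Qed.

Theorem theorem1p7 (R : realType) (k : nat) (alpha beta : R) (l : nat -> nat) :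
  (0 < k)%N ->
  0 < alpha -> alpha < 1 -> 0 < beta -> beta < 1 -> 1 <= alpha + beta ->
  (forall n, (2 <= l n)%N) ->
  little_o_sqrt R l ->
  exists N : nat, forall n : nat, (N <= n)%N ->
    exists s : seq {set 'I_n},
      [/\ uniq s,
          (forall A : {set 'I_n}, (A \in s) = (#|A| == k)),
          (forall i a b : nat, (a < l n)%N -> (b < l n)%N -> a <> b ->
              [disjoint cyc s (i + a) & cyc s (i + b)]) &
          (forall i j : nat,
              (forall a b : nat, (a < l n)%N -> (b < l n)%N ->
                  ((i + a) %% size s)%N <> ((j + b) %% size s)%N) ->
              ~ close k alpha beta (window s (l n) i) (window s (l n) j))].
Proof.
move=> k0 _ _ _ _ hab l2 lo.
pose C := threshold k.
(* This [eps] yields [((C + 1) * l n) ^ 2 <= n] after squaring, hence the strict [C * l n ^ 2 < n]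
   because [l n > 0]. *)
have [N0 hN0] := lo (C.+1%:R^-1) (ltac:(by rewrite invr_gt0)).
exists (N0 + 2 * k)%N => n hn.
have n0 : (0 < n)%N by lia.
have lt : (threshold k * l n ^ 2 < n)%N.
  have := hN0 n (ltac:(lia)).
  rewrite -ler_pdivrMl ?invr_gt0 // invrK => h.
  have : (C.+1%:R * (l n)%:R) ^+ 2 <= (Num.sqrt n%:R) ^+ 2 :> R.
    by rewrite lerXn2r // ?nnegrE ?mulr_ge0 // sqrtr_ge0.
  rewrite sqr_sqrtr // -natrM -natrX ler_nat.
  have := l2 n; rewrite -/C => h2 h3; apply: leq_trans h3.
  by rewrite expnMn ltn_pmul2r ?expn_gt0; nia.
have small := forbidden_small k0 (ltac:(lia) : (2 * k <= n)%N) lt.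
have [s [[us ks ds cs] ss]] := exists_good k0 small.
(* A window must not wrap onto itself; [l n] is at most [2 * forbidden], hence below ['C(n, k)]. *)
have ls : (l n <= size s)%N.
  rewrite ss; apply: leq_trans (ltnW small); rewrite /forbidden.
  have : (0 < 2 ^ k * n ^ k.-1)%N by rewrite muln_gt0 !expn_gt0 n0.
  by nia.
have cyc_neq p q : (p %% size s <> q %% size s)%N -> cyc s p != cyc s q.
  have s0 : (0 < size s)%N by have := l2 n; lia.
  by move=> /eqP ne; rewrite /cyc nth_uniq ?ltn_mod.
exists s; split=> //.
- move=> A; apply/idP/eqP => [/ks //|kA].
  (* Inclusion together with equal cardinality shows that every [k]-set is listed. *)
  have sub : [set B in s] \subset [set B : {set 'I_n} | #|B| == k].
    by apply/subsetP => B; rewrite !inE => /ks ->.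
  have /setP/(_ A) : [set B in s] = [set B : {set 'I_n} | #|B| == k].
    by apply/eqP; rewrite eqEcard sub card_draws card_ord -ss
      cardsE (card_uniqP us) /=.
  by rewrite !inE kA eqxx.
- move=> i a b la lb neab; rewrite -setI_eq0 -cards_eq0; apply/eqP.
  apply: ds; last exact: near_cyc.
  apply: cyc_neq => /eqP; rewrite eqn_modDl !modn_small; [|lia..].
  by move/eqP.
move=> i j hij [A1 [B1 [A2 [B2 [[+ + ne1] [[+ + ne2] [hA hB]]]]]]].
move=> /imsetP[a1 _ eA1] /imsetP[b1 _ eB1] /imsetP[a2 _ eA2] /imsetP[b2 _ eB2].
have : (#|A1 :&: A2| + #|B1 :&: B2| <= k)%N.
  apply: cs => //.
  - by rewrite eA1 eB1; apply: near_cyc => //; apply: ltn_ord.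
  - by rewrite eA2 eB2; apply: near_cyc => //; apply: ltn_ord.
  - by rewrite eA1 eA2; apply/cyc_neq/hij; apply: ltn_ord.
  - by rewrite eB1 eB2; apply/cyc_neq/hij; apply: ltn_ord.
(* Closeness would make the sum exceed [(alpha + beta) * k], which is at least [k]. *)
rewrite -(ler_nat R) natrD; apply/negP; rewrite -ltNge.
apply: le_lt_trans (ltrD hA hB).
by rewrite -mulrDl ler_peMl.
Qed.
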